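(* Let $\Delta=\Gamma\delta\Gamma\subset\mathcal M$ ($\delta\in\mathcal M$) be a double coset. Then every $\xi\in\mathcal A_\Delta$ satisfies $$(1-S)\xi\equiv\alpha\cdot T_\Delta^\infty(1-S)\pmod{(1-T)\mathcal R_\Delta}$$ for a unique number $\alpha=\alpha(\xi)\in\mathbb Q$.
   Context: Let $\Gamma=\mathrm{PSL}_2(\mathbb Z)$, $S=\pm\begin{pmatrix}0&-1\\1&0\end{pmatrix}$, $U=\pm\begin{pmatrix}1&-1\\1&0\end{pmatrix}$, $T=US=\pm\begin{pmatrix}1&1\\0&1\end{pmatrix}$. Let $\mathcal M$ be the set of $2\times2$ integer matrices of positive determinant modulo $\{\pm1\}$, $\mathcal R=\mathbb Q[\mathcal M]$ the $\mathbb Q$-algebra of formal finite linear combinations with multiplication extending matrix multiplication ($1$ = identity). Put $\pi_S=(1+S)/2$, $\pi_U=(1+U+U^2)/3$, $\mathcal I=\pi_S\mathcal R+\pi_U\mathcal R$, $\mathcal A=\{\xi\in\mathcal R:\xi\pi_S\in\mathcal I,\ \xi\pi_U\in\mathcal I\}$. For a double coset $\Delta$ let $\mathcal R_\Delta=\mathbb Q[\Delta]$ and $\mathcal A_\Delta=\mathcal A\cap\mathcal R_\Delta$. Let $T_\Delta^\infty=\sum_{M\in\mathcal M^\infty_\Delta}M$, where $\mathcal M_\Delta^\infty\subset\Delta$ is a set of representatives of $\Gamma\backslash\Delta$ consisting of matrices fixing $\infty$ (lower-left entry $0$). Congruence modulo $(1-T)\mathcal R_\Delta$ means the difference lies in $(1-T)\mathcal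 R_\Delta$. *)

(* Defs.v *)
From HB Require Import structures.
From Stdlib Require Import Classical.
From mathcomp Require Import all_boot all_order all_algebra.
From mathcomp Require Import generic_quotient finmap zify ring.
From mathcomp Require Import monalg.

Set Implicit Arguments.
Unset Strict Implicit.
Unset Printing Implicit Defensive.

Import Order.TTheory GRing.Theory Num.Theory.

Local Open Scope fset_scope.
Local Open Scope ring_scope.
Local Open Scope quotient_scope.

(* The convolution ring that monalg puts on {malg R[K]} requires K to be a
   monomType, where 1 is the only invertible element.  This excludes the
   monoid below, so galg repeats the construction for any monoidType.        *)
Definition galg (K : monoidType) (R : comNzRingType) : Type := {malg R[K]}.
Bind Scope ring_scope with galg.

HB.instance Definition _ (K : monoidType) (R : comNzRingType) :=
  GRing.Lmodule.copy (galg K R) {malg R[K]}.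

Section MonoidAlgebra.
Variables (K : monoidType) (R : comNzRingType).
Implicit Types (g : {malg R[K]}) (k : K).

Definition gone : {malg R[K]} := << 1%g >>.

Definition gmul g1 g2 : {malg R[K]} :=
  \sum_(k1 <- msupp g1) \sum_(k2 <- msupp g2) << g1@_k1 * g2@_k2 *g (k1 * k2)%g >>.

Lemma gmulr g1 g2 : gmul g1 g2 =
  \sum_(k2 <- msupp g2) \sum_(k1 <- msupp g1) << g1@_k1 * g2@_k2 *g (k1 * k2)%g >>.
Proof. by rewrite /gmul exchange_big. Qed.

Lemma gmullw (d1 d2 : {fset K}) g1 g2 :
  msupp g1 `<=` d1 -> msupp g2 `<=` d2 ->
  gmul g1 g2 = \sum_(k1 <- d1) \sum_(k2 <- d2) << g1@_k1 * g2@_k2 *g (k1 * k2)%g >>.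
Proof.
move=> le_d1 le_d2; rewrite /gmul (big_fset_incl _ le_d1) /=.
  apply/eq_bigr=> k1 _; apply/big_fset_incl => // k _ /mcoeff_outdom ->.
  by rewrite mulr0 monalgU0.
move=> k _ /mcoeff_outdom g1k.
by rewrite big1 => // k' _; rewrite g1k mul0r monalgU0.
Qed.

Lemma gmulrw (d1 d2 : {fset K}) g1 g2 :
  msupp g1 `<=` d1 -> msupp g2 `<=` d2 ->
  gmul g1 g2 = \sum_(k2 <- d2) \sum_(k1 <- d1) << g1@_k1 * g2@_k2 *g (k1 * k2)%g >>.
Proof. by move=> le_d1 le_d2; rewrite (gmullw le_d1 le_d2) exchange_big. Qed.

Lemma gmul0g : left_zero 0 gmul.
Proof. by move=> g; rewrite /gmul msupp0 big_seq_fset0. Qed.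

Lemma gmulg0 : right_zero 0 gmul.
Proof. by move=> g; rewrite gmulr msupp0 big_seq_fset0. Qed.

Lemma gmulUg c k g :
  gmul << c *g k >> g = \sum_(k' <- msupp g) << c * g@_k' *g (k * k')%g >>.
Proof.
rewrite (gmullw msuppU_le (fsubset_refl _)) big_seq_fset1.
by apply/eq_bigr => k' _; rewrite mcoeffUU.
Qed.

Lemma gmulgU c k g :
  gmul g << c *g k >> = \sum_(k' <- msupp g) << g@_k' * c *g (k' * k)%g >>.
Proof.
rewrite (gmulrw (fsubset_refl _) msuppU_le) big_seq_fset1.
by apply/eq_bigr=> k' _; rewrite mcoeffUU.
Qed.

Lemma gmulUU c1 c2 k1 k2 :
  gmul << c1 *g k1 >> << c2 *g k2 >> = << c1 * c2 *g (k1 * k2)%g >>.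
Proof. by rewrite (gmulrw msuppU_le msuppU_le) !big_seq_fset1 !mcoeffUU. Qed.

Lemma gmulEl1 g1 g2 :
  gmul g1 g2 = \sum_(k1 <- msupp g1) gmul << g1@_k1 *g k1 >> g2.
Proof. by apply/eq_bigr=> k _; rewrite gmulUg. Qed.

Lemma gmulEr1 g1 g2 :
  gmul g1 g2 = \sum_(k2 <- msupp g2) gmul g1 << g2@_k2 *g k2 >>.
Proof. by rewrite gmulr; apply/eq_bigr=> k _; rewrite gmulgU. Qed.

Lemma gmul1g : left_id gone gmul.
Proof.
move=> g; rewrite gmulUg [RHS]monalgE.
by apply/eq_bigr=> kg _; rewrite mul1r mul1g.
Qed.

Lemma gmulg1 : right_id gone gmul.
Proof.
move=> g; rewrite gmulgU [RHS]monalgE.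
by apply/eq_bigr=> k _; rewrite mulr1 mulg1.
Qed.

Lemma gmulgDl : left_distributive gmul +%R.
Proof.
move=> g1 g2 g.
rewrite [in RHS](gmullw (fsubsetUl _ (msupp g2)) (fsubset_refl _)).
rewrite [in RHS](gmullw (fsubsetUr (msupp g1) _) (fsubset_refl _)).
rewrite (gmullw (msuppD_le _ _) (fsubset_refl _)).
rewrite -big_split /=; apply/eq_bigr=> k1 _.
rewrite -big_split /=; apply/eq_bigr=> k2 _.
by rewrite mcoeffD mulrDl monalgUD.
Qed.

Lemma gmulgDr : right_distributive gmul +%R.
Proof.
move=> g g1 g2.
rewrite [in RHS](gmulrw (fsubset_refl _) (fsubsetUl _ (msupp g2))).
rewrite [in RHS](gmulrw (fsubset_refl _) (fsubsetUr (msupp g1) _)).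
rewrite (gmulrw (fsubset_refl _) (msuppD_le _ _)).
rewrite -big_split /=; apply/eq_bigr => k1 _.
rewrite -big_split /=; apply/eq_bigr => k2 _.
by rewrite mcoeffD mulrDr monalgUD.
Qed.

Lemma gmulA : associative gmul.
Proof.
move=> g1 g2 g3.
rewrite [RHS](big_morph (gmul^~ _) (fun _ _ => gmulgDl _ _ _) (gmul0g _)).
rewrite gmulEl1; apply/eq_bigr=> k1 _.
rewrite [LHS](big_morph (gmul _) (fun _ _ => gmulgDr _ _ _) (gmulg0 _)).
rewrite [RHS](big_morph (gmul^~ _) (fun _ _ => gmulgDl _ _ _) (gmul0g _)).
apply/eq_bigr=> k2 _.
rewrite [LHS](big_morph (gmul _) (fun _ _ => gmulgDr _ _ _) (gmulg0 _)).
by rewrite gmulEr1; apply/eq_bigr=> k3 _; rewrite !gmulUU mulrA mulgA.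
Qed.

Lemma goner_eq0 : gone != 0.
Proof. by apply/eqP/malgP=> /(_ 1%g) /eqP; rewrite !mcoeffsE oner_eq0. Qed.

Lemma gscaleUl (c : R) g : c *: g = gmul << c *g 1%g >> g.
Proof. by rewrite gmulUg; apply/eq_bigr => k _; rewrite mul1g. Qed.

Lemma gscaleUr (c : R) g : c *: g = gmul g << c *g 1%g >>.
Proof. by rewrite gmulgU; apply/eq_bigr => k _; rewrite mulg1 mulrC. Qed.

Lemma gscaleAl (c : R) g1 g2 : c *: gmul g1 g2 = gmul (c *: g1) g2.
Proof. by rewrite !gscaleUl gmulA. Qed.

Lemma gscaleAr (c : R) g1 g2 : c *: gmul g1 g2 = gmul g1 (c *: g2).
Proof. by rewrite !gscaleUr gmulA. Qed.

HB.instance Definition _ := GRing.Zmodule_isNzRing.Build (galg K R)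
  gmulA gmul1g gmulg1 gmulgDl gmulgDr goner_eq0.
HB.instance Definition _ := GRing.Lmodule_isLalgebra.Build R (galg K R) gscaleAl.
HB.instance Definition _ := GRing.Lalgebra_isAlgebra.Build R (galg K R) gscaleAr.

End MonoidAlgebra.

(* -------------------------------------------------------------------------- *)

Definition mx2 (a b c d : int) : 'M[int]_2 :=
  \matrix_(i, j) (if i == 0 then (if j == 0 then a else b)
                  else (if j == 0 then c else d)).

Lemma det_mx2 (A : 'M[int]_2) : \det A = A 0 0 * A 1 1 - A 0 1 * A 1 0.
Proof.
rewrite (expand_det_row _ 0) !big_ord_recl big_ord0 addr0 /cofactor !det_mx11.
rewrite !mxE /= !(expr0, expr1) mul1r mulN1r mulrN.
by congr (A _ _ * A _ _ - A _ _ * A _ _); apply/val_inj.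
Qed.

Lemma det_mx2E a b c d : \det (mx2 a b c d) = a * d - b * c.
Proof. by rewrite det_mx2 !mxE. Qed.

Definition posmx := {A : 'M[int]_2 | 0 < \det A}.
HB.instance Definition _ := Choice.on posmx.

Definition pmeq (A B : posmx) : bool := (val A == val B) || (val A == - val B).

Lemma pmeq_refl : reflexive pmeq.
Proof. by move=> A; rewrite /pmeq eqxx. Qed.

Lemma pmeq_sym : symmetric pmeq.
Proof. by move=> A B; rewrite /pmeq eq_sym -eqr_oppLR (eq_sym (- _)). Qed.

Lemma pmeq_trans : transitive pmeq.
Proof.
move=> B A C /orP[] /eqP + /orP[] /eqP; rewrite /pmeq => -> ->;
  by rewrite ?opprK eqxx ?orbT.
Qed.

Canonical pmeq_equiv := EquivRel pmeq pmeq_refl pmeq_sym pmeq_trans.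

Definition PM2 : Type := {eq_quot pmeq}.
HB.instance Definition _ := Choice.on PM2.
HB.instance Definition _ := EqQuotient.on PM2.

Lemma posmx1_subproof : 0 < \det (1%:M : 'M[int]_2).
Proof. by rewrite det1. Qed.

Lemma posmxM_subproof (A B : posmx) : 0 < \det (val A *m val B).
Proof. by rewrite det_mulmx mulr_gt0 ?(valP A) ?(valP B). Qed.

Definition posmx1 : posmx := Sub 1%:M posmx1_subproof.
Definition posmxM (A B : posmx) : posmx := Sub (val A *m val B) (posmxM_subproof A B).

Definition pm1 : PM2 := \pi posmx1.
Definition pmM : PM2 -> PM2 -> PM2 := lift_op2 PM2 posmxM.

Lemma pi_eqP (A B : posmx) :
  reflect (val A = val B \/ val A = - val B) (\pi_PM2 A == \pi_PM2 B).
Proof.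
by rewrite piE; apply: (iffP orP) => -[] => [/eqP|/eqP|/eqP|/eqP]; [left|right|left|right].
Qed.

Lemma val_reprP (A : posmx) :
  val (repr (\pi_PM2 A)) = val A \/ val (repr (\pi_PM2 A)) = - val A.
Proof. by apply/pi_eqP; rewrite reprK. Qed.

Lemma pi_pmM : {morph \pi_PM2 : A B / posmxM A B >-> pmM A B}.
Proof.
move=> A B; unlock pmM; apply/eqP/pi_eqP => /=.
by case: (val_reprP A) => ->; case: (val_reprP B) => ->;
  rewrite ?(mulmxN, mulNmx, opprK); [left|right|right|left].
Qed.
Canonical pi_pmM_morph := PiMorph2 pi_pmM.

Lemma pmMA : associative pmM.
Proof.
elim/quotW=> A; elim/quotW=> B; elim/quotW=> C; rewrite !piE.
by apply/eqP/pi_eqP; left; rewrite /= mulmxA.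
Qed.

Lemma pm1M : left_id pm1 pmM.
Proof.
elim/quotW=> A; rewrite /pm1 !piE.
by apply/eqP/pi_eqP; left; rewrite /= mul1mx.
Qed.

Lemma pmM1 : right_id pm1 pmM.
Proof.
elim/quotW=> A; rewrite /pm1 !piE.
by apply/eqP/pi_eqP; left; rewrite /= mulmx1.
Qed.

HB.instance Definition _ := isMonoid.Build PM2 pmMA pm1M pmM1.

Definition pm_det : PM2 -> int := lift_fun1 PM2 (fun A : posmx => \det (val A)).

Lemma pi_pm_det : {mono \pi_PM2 : A / \det (val A) >-> pm_det A}.
Proof.
move=> A; unlock pm_det => /=.
by case: (val_reprP A) => -> //; rewrite !det_mx2 !mxE !mulrNN.
Qed.
Canonical pi_pm_det_mono := PiMono1 pi_pm_det.

Definition fixes_inf : pred PM2 :=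
  lift_fun1 PM2 (fun A : posmx => val A 1 0 == 0).

Lemma pi_fixes_inf : {mono \pi_PM2 : A / val A 1 0 == 0 >-> fixes_inf A}.
Proof.
move=> A; unlock fixes_inf => /=.
by case: (val_reprP A) => -> //; rewrite mxE oppr_eq0.
Qed.
Canonical pi_fixes_inf_mono := PiMono1 pi_fixes_inf.

Definition PSL2Z : {pred PM2} := [pred g | pm_det g == 1].

Definition pmcls (A : 'M[int]_2) (hA : 0 < \det A) : PM2 := \pi_PM2 (Sub A hA).

Lemma S_subproof : 0 < \det (mx2 0 (-1) 1 0). Proof. by rewrite det_mx2E. Qed.
Lemma U_subproof : 0 < \det (mx2 1 (-1) 1 0). Proof. by rewrite det_mx2E. Qed.
Lemma T_subproof : 0 < \det (mx2 1 1 0 1). Proof. by rewrite det_mx2E. Qed.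

Definition matS : PM2 := pmcls S_subproof.
Definition matU : PM2 := pmcls U_subproof.
Definition matT : PM2 := pmcls T_subproof.

Lemma matT_US : matT = (matU * matS)%g.
Proof.
rewrite /matT /matU /matS /pmcls [RHS]piE; apply/eqP/pi_eqP; right; apply/matrixP => i j /=.
rewrite !mxE !big_ord_recl big_ord0 !mxE /=.
by case: i => -[|[|[]]] //= ?; case: j => -[|[|[]]].
Qed.

(* -------------------------------------------------------------------------- *)

Definition QM2 : Type := galg PM2 rat.
HB.instance Definition _ := GRing.Algebra.on QM2.
Bind Scope ring_scope with QM2.

Definition mon (m : PM2) : QM2 := << m >>.

Lemma monM (m1 m2 : PM2) : mon (m1 * m2)%g = mon m1 * mon m2.
Proof. by rewrite /mon -[in LHS](mulr1 1) -gmulUU. Qed.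

Definition piS : QM2 := 2^-1 *: (1 + mon matS).
Definition piU : QM2 := 3^-1 *: (1 + mon matU + mon matU ^+ 2).

Definition in_I (x : QM2) : Prop := exists a b : QM2, x = piS * a + piU * b.

Definition in_A (x : QM2) : Prop := in_I (x * piS) /\ in_I (x * piU).

Definition double_coset (delta m : PM2) : Prop :=
  exists g h : PM2, [/\ g \in PSL2Z, h \in PSL2Z & m = (g * delta * h)%g].

Definition in_R (Delta : PM2 -> Prop) (x : QM2) : Prop :=
  forall m : PM2, m \in msupp x -> Delta m.

Definition in_AR (Delta : PM2 -> Prop) (x : QM2) : Prop := in_A x /\ in_R Delta x.

Definition eqmod_1T (Delta : PM2 -> Prop) (x y : QM2) : Prop :=
  exists2 z : QM2, in_R Delta z & x - y = (1 - mon matT) * z.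

(* E contains exactly one element of each coset in PSL2Z \ Delta.             *)
Definition inf_reps (Delta : PM2 -> Prop) (E : {fset PM2}) : Prop :=
  (forall r, r \in E -> Delta r /\ fixes_inf r) /\
  (forall m, Delta m ->
    exists! r, r \in E /\ exists2 g, g \in PSL2Z & m = (g * r)%g).

Definition Tinf (E : {fset PM2}) : QM2 := \sum_(r <- E) mon r.

Lemma mx2_eta (A : 'M[int]_2) : A = mx2 (A 0 0) (A 0 1) (A 1 0) (A 1 1).
Proof.
apply/matrixP => i j; rewrite mxE; case: (i =P 0) => [->|/eqP i0];
  case: (j =P 0) => [->|/eqP j0] //; congr (A _ _); apply/val_inj => /=.
- by case: j j0 => -[|[|[]]].
- by case: i i0 => -[|[|[]]].
- by case: i i0 => -[|[|[]]].
- by case: j j0 => -[|[|[]]].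
Qed.

Lemma mx2M a b c d a' b' c' d' : mx2 a b c d *m mx2 a' b' c' d' =
  mx2 (a * a' + b * c') (a * b' + b * d') (c * a' + d * c') (c * b' + d * d').
Proof. by rewrite [LHS]mx2_eta !mxE !big_ord_recl !big_ord0 !mxE /= !addr0. Qed.

Lemma mx2_inj a b c d a' b' c' d' : mx2 a b c d = mx2 a' b' c' d' ->
  [/\ a = a', b = b', c = c' & d = d'].
Proof.
move=> /matrixP E.
by have := (E 0 0, E 0 1, E 1 0, E 1 1); rewrite !mxE /= => -[[[]]].
Qed.

Lemma mx2N a b c d : - mx2 a b c d = mx2 (- a) (- b) (- c) (- d).
Proof. by rewrite [LHS]mx2_eta !mxE. Qed.

Definition hermite (a b d : int) : Prop := [/\ 0 < a, 0 <= b < d & 0 < d].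

Definition is_hermite (m : PM2) : Prop :=
  exists a b d (h : 0 < \det (mx2 a b 0 d)), hermite a b d /\ m = pmcls h.

Lemma hermite_col (a c : int) : (a != 0) || (c != 0) ->
  exists p q s t : int, [/\ p * t - q * s = 1, s * a + t * c = 0 & 0 < p * a + q * c].
Proof.
move=> ac0; have [u [v E]] := Bezoutz a c.
have g0 : gcdz a c != 0 by rewrite gcdz_eq0 negb_and.
have /dvdzP [a' Ea] := dvdz_gcdl a c.
have /dvdzP [c' Ec] := dvdz_gcdr a c.
move: (gcdz a c) (isT : 0 <= gcdz a c) E g0 Ea Ec => g g_ge0 E g0 Ea Ec.
exists u, v, (- c'), a'; split; last by rewrite E lt0r g0.
- apply: (mulIf g0); rewrite mul1r -{2}E Ea Ec; ring.
- rewrite Ea Ec; ring.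
Qed.

Lemma hermite_exists (m : PM2) :
  exists2 g, g \in PSL2Z & exists2 r, is_hermite r & m = (g * r)%g.
Proof.
elim/quotW: m => A; have := valP A; rewrite det_mx2.
move: (mx2_eta (val A)).
move: (val A 0 0) (val A 0 1) (val A 1 0) (val A 1 1) => a b c d EA /= detA.
have ac0 : (a != 0) || (c != 0).
  by apply: contraTT detA; rewrite negb_or !negbK => /andP[/eqP-> /eqP->]; lia.
have [p [q [s [t [E1 E2 E3]]]]] := hermite_col ac0.
set a1 := p * a + q * c in E3; pose b1 := p * b + q * d; pose d1 := s * b + t * d.
have Ed : a1 * d1 = a * d - b * c.
  rewrite -[RHS]mul1r -E1 /a1 /d1.
  have -> : (p * a + q * c) * (s * b + t * d) =
    (p * t - q * s) * (a * d - b * c) + (s * a + t * c) * (p * b + q * d) by ring.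
  by rewrite E2 mul0r addr0.
have d1_gt0 : 0 < d1 by move: detA; rewrite -Ed pmulr_rgt0.
pose k := (b1 %/ d1)%Z; pose b2 := (b1 %% d1)%Z.
have Eb : b1 = k * d1 + b2 by apply: divz_eq.
have hg : 0 < \det (mx2 t (k * t - q) (- s) (p - k * s)).
  rewrite det_mx2E; have -> : t * (p - k * s) - (k * t - q) * - s = p * t - q * s by ring.
  by rewrite E1.
have hr : 0 < \det (mx2 a1 b2 0 d1) by rewrite det_mx2E mulr0 subr0 mulr_gt0.
exists (pmcls hg).
  rewrite inE /pmcls piE /= det_mx2E; apply/eqP; rewrite -E1; ring.
exists (pmcls hr).
  exists a1, b2, d1, hr; split=> //; split=> //.
  by rewrite modz_ge0 ?gt_eqF //= ltz_pmod.
rewrite /pmcls [RHS]piE; apply/eqP/pi_eqP; left; rewrite /= EA mx2M.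
have Eb2 : b2 = b1 - k * d1 by rewrite Eb addrAC subrr add0r.
have Ep x : x = (p * t - q * s) * x by rewrite E1 mul1r.
congr mx2.
- rewrite {1}[a]Ep mulr0 addr0 /a1.
  have -> : t * (p * a + q * c) = (p * t - q * s) * a + q * (s * a + t * c) by ring.
  by rewrite E2 mulr0 addr0.
- rewrite {1}[b]Ep Eb2 /b1 /d1; ring.
- rewrite {1}[c]Ep mulr0 addr0 /a1.
  have -> : - s * (p * a + q * c) = (p * t - q * s) * c - p * (s * a + t * c) by ring.
  by rewrite E2 mulr0 subr0.
- rewrite {1}[d]Ep Eb2 /b1 /d1; ring.
Qed.

Lemma hermite_uniq (r r' g g' : PM2) : is_hermite r -> is_hermite r' ->
  g \in PSL2Z -> g' \in PSL2Z -> (g * r = g' * r')%g -> r = r'.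
Proof.
move=> [a [b [d [h [[a_gt0 /andP[b_ge0 b_lt] d_gt0] ->]]]]].
move=> [a' [b' [d' [h' [[a'_gt0 /andP[b'_ge0 b'_lt] d'_gt0] ->]]]]].
elim/quotW: g => G; elim/quotW: g' => G'; rewrite !inE !piE => /eqP detG /eqP detG'.
rewrite /pmcls [X in X = _]piE [X in _ = X]piE => /eqP/pi_eqP /= E.
suff [Ea Eb Ed] : [/\ a = a', b = b' & d = d'].
  by apply/eqP/pi_eqP; left; rewrite /= Ea Eb Ed.
have [P detP EP] : exists2 P : 'M[int]_2, \det P = 1 &
    P *m mx2 a b 0 d = mx2 a' b' 0 d'.
  have det_adj : \det (\adj (val G')) = 1.
    by rewrite -[LHS]mulr1 -[X in _ * X]detG' -det_mulmx mul_adj_mx detG' det1.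
  case: E => E; [exists (\adj (val G') *m val G)|exists (- (\adj (val G') *m val G))].
  - by rewrite det_mulmx det_adj detG.
  - by rewrite -mulmxA E mulmxA mul_adj_mx detG' mul1mx.
  - have -> : \det (- (\adj (val G') *m val G)) = \det (\adj (val G') *m val G).
      by rewrite !det_mx2 !mxE !mulrNN.
    by rewrite det_mulmx det_adj detG.
  - by rewrite mulNmx -mulmxA E mulmxN opprK mulmxA mul_adj_mx detG' mul1mx.
move: detP EP; rewrite det_mx2 (mx2_eta P) !mxE /=.
move: (P 0 0) (P 0 1) (P 1 0) (P 1 1) => p q s t detP; rewrite mx2M.
case/mx2_inj; rewrite !mulr0 !addr0 => Epa Epb /eqP; rewrite mulf_eq0.
rewrite (gt_eqF a_gt0) orbF => /eqP s0; rewrite s0 mul0r add0r => Etd.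
move: detP; rewrite s0 mulr0 subr0 => pt1.
have p_gt0 : 0 < p by rewrite -(pmulr_lgt0 _ a_gt0) Epa.
have t_gt0 : 0 < t by rewrite -(pmulr_rgt0 _ p_gt0) pt1.
have p1 : p = 1 by nia.
have t1 : t = 1 by rewrite p1 mul1r in pt1.
move: Epa Epb Etd; rewrite p1 t1 !mul1r => Ea Eb Ed; split=> //.
have : q = 0.
  have [q_le0|q_gt0] := lerP q 0; last by nia.
  have [q_lt0|q_ge0] := ltrP q 0; last by lia.
  by nia.
by move=> q0; move: Eb; rewrite q0 mul0r addr0.
Qed.

Lemma filter_Prop (T : eqType) (P : T -> Prop) (s : seq T) :
  exists s' : seq T, forall x, x \in s' <-> x \in s /\ P x.
Proof.
elim: s => [|y s [s' IH]]; first by exists [::] => x; split=> [|[]].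
case: (classic (P y)) => Py; [exists (y :: s')|exists s'] => x; rewrite !inE.
- split=> [/orP[/eqP->|/IH[xs Px]]|[/orP[/eqP->|xs] Px]].
  + by rewrite eqxx.
  + by rewrite xs orbT.
  + by rewrite eqxx.
  + by apply/orP; right; apply/IH.
- split=> [/IH[xs Px]|[/orP[/eqP->|xs] Px]] //; first by rewrite xs orbT.
  by apply/IH.
Qed.

Lemma pm_detM (m1 m2 : PM2) : pm_det (m1 * m2)%g = pm_det m1 * pm_det m2.
Proof.
elim/quotW: m1 => A; elim/quotW: m2 => B.
have -> : (\pi_PM2 A * \pi_PM2 B)%g = \pi_PM2 (posmxM A B) by rewrite [LHS]piE.
by rewrite !piE /= det_mulmx.
Qed.

Lemma PSL2Z_mul (g h : PM2) : g \in PSL2Z -> h \in PSL2Z -> (g * h)%g \in PSL2Z.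
Proof. by rewrite !inE pm_detM => /eqP-> /eqP->. Qed.

Lemma PSL2Z_inv (g : PM2) : g \in PSL2Z ->
  exists2 g', g' \in PSL2Z & (g' * g = 1)%g.
Proof.
elim/quotW: g => G; rewrite inE piE => /eqP detG.
have h : 0 < \det (\adj (val G)).
  have : \det (\adj (val G)) = 1.
    by rewrite -[LHS]mulr1 -[X in _ * X]detG -det_mulmx mul_adj_mx detG det1.
  by move=> ->.
exists (pmcls h).
  rewrite inE /pmcls piE /=; apply/eqP.
  by rewrite -[LHS]mulr1 -[X in _ * X]detG -det_mulmx mul_adj_mx detG det1.
rewrite /pmcls [LHS]piE; apply/eqP/pi_eqP; left => /=.
by rewrite mul_adj_mx detG.
Qed.

Lemma double_coset_det (delta m : PM2) :
  double_coset delta m -> pm_det m = pm_det delta.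
Proof.
by move=> [g [h [+ + ->]]]; rewrite !inE !pm_detM => /eqP-> /eqP->; rewrite mul1r mulr1.
Qed.

Lemma double_coset_mull (delta g m : PM2) :
  g \in PSL2Z -> double_coset delta m -> double_coset delta (g * m)%g.
Proof.
move=> gG [g1 [h [g1G hG ->]]]; exists (g * g1)%g, h; split=> //.
  exact: PSL2Z_mul.
by rewrite !mulgA.
Qed.

(* inf_reps is never a vacuous hypothesis: the Hermite normal forms in the
   double coset are such a system of representatives.                         *)
Lemma inf_reps_exists (delta : PM2) :
  exists E : {fset PM2}, inf_reps (double_coset delta) E.
Proof.
pose n := absz (pm_det delta).
pose I := iota 0 n.+1.
pose L := [seq mx2 ab.1%:Z ab.2%:Z 0 d%:Z | ab <- [seq (a, b) | a <- I, b <- I], d <- I].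
pose s : seq PM2 := [seq \pi_PM2 A | A <- pmap insub L].
have sP m : double_coset delta m -> is_hermite m -> m \in s.
  move=> Dm [a [b [d [h [[a_gt0 /andP[b_ge0 b_lt] d_gt0] Em]]]]].
  have := double_coset_det Dm; rewrite Em /pmcls piE /= det_mx2E mulr0 subr0 => Ead.
  apply: map_f; rewrite mem_pmap; apply/mapP; exists (mx2 a b 0 d); last first.
    by rewrite (insubT (fun A : 'M[int]_2 => 0 < \det A) h).
  have memI (x : int) : 0 <= x <= a * d -> absz x \in I.
    by rewrite mem_iota add0n ltnS /n -Ead; lia.
  have -> : mx2 a b 0 d = mx2 (absz a)%:Z (absz b)%:Z 0 (absz d)%:Z.
    by rewrite !gez0_abs // ltW.
  apply: (allpairs_f (fun ab d => mx2 ab.1%:Z ab.2%:Z 0 d%:Z) (x := (absz a, absz b))).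
    by apply: (allpairs_f pair); apply: memI; nia.
  by apply: memI; nia.
have [s' s'P] := filter_Prop (fun m => double_coset delta m /\ is_hermite m) s.
have EP r : (r \in [fset x in s']) = (r \in s') by rewrite !inE.
exists [fset x in s']; split=> [r|m Dm].
  rewrite EP => /s'P[_ [Dr [a [b [d [h [_ Er]]]]]]]; split=> //; rewrite Er.
  by rewrite /pmcls piE /= !mxE.
have [g gG [r hr Em]] := hermite_exists m.
have [g' g'G g'g] := PSL2Z_inv gG.
have Er : r = (g' * m)%g by rewrite Em mulgA g'g mul1g.
have Dr : double_coset delta r by rewrite Er; apply: double_coset_mull.
exists r; split.
  split; last by exists g.
  by rewrite EP; apply/s'P; split=> //; apply: sP.
move=> r'; rewrite EP => -[/s'P[_ [_ hr']] [h hG Em']].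
by apply: (hermite_uniq hr hr' gG hG); rewrite -Em -Em'.
Qed.

(* Main.v *)
(* Let Z(m) be the sum of the coefficients of z = (1-S)xi over the orbit <T>m.
   Since (1-S)I lies in (1-T)R, the relations defining A become
   Z(m) + Z(mS) = 0 and Z(m) + Z(mU) + Z(mU^2) = 0: Z is a finitely supported
   cycle on the quotient by <T> of a disjoint union of copies of the tree of
   PSL2(Z) = Z/2 * Z/3.  Away from the orbits with a zero in the bottom row
   (c, d), the cycle relations propagate nonzero values to ever larger
   |c| + |d|, so Z is supported on cd = 0, and the relations also make Z
   right T-invariant on c = 0.  Hence z = sum_r Z(r) r(1-S) modulo (1-T)R,
   r running over the chosen representatives.  Finally z has zero total
   coefficient on every coset Gamma m, so m |-> Z(r), r in Gamma m, is right
   invariant under S; it is right invariant under T as well, and therefore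
   constant on the double coset, since S and T generate Gamma. *)
Require Import Defs.
From mathcomp Require Import boolp.
From mathcomp Require Import all_boot all_order all_algebra finmap zify ring lra.
From mathcomp Require Import monalg.

Import Order.TTheory GRing.Theory Num.Theory.
Local Open Scope ring_scope.

Set Implicit Arguments.
Unset Strict Implicit.
Unset Printing Implicit Defensive.

(** * Linear functionals on the algebra and coefficient sums over classes *)

Section Pairing.
Variable phi : PM2 -> rat.

Definition pairing (x : QM2) : rat := mmap idfun phi (x : {malg rat[PM2]}).

Lemma pairingE (x : QM2) : pairing x = \sum_(k <- msupp x) x@_k * phi k.
Proof. exact: mmapE. Qed.

Lemma pairingD x y : pairing (x + y) = pairing x + pairing y.
Proof. exact: mmapD. Qed.

Lemma pairingB x y : pairing (x - y) = pairing x - pairing y.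
Proof. exact: mmapB. Qed.

Lemma pairingU c k : pairing << c *g k >> = c * phi k.
Proof. exact: mmapU. Qed.

Lemma pairing0 : pairing 0 = 0.
Proof. exact: mmap0. Qed.

Lemma pairing_sum (I : Type) (s : seq I) (F : I -> QM2) :
  pairing (\sum_(i <- s) F i) = \sum_(i <- s) pairing (F i).
Proof. exact: (big_morph _ pairingD pairing0). Qed.

Lemma pairing_mon m : pairing (mon m) = phi m.
Proof. by rewrite pairingU mul1r. Qed.

Lemma pairing_monB m n : pairing (mon m - mon n) = phi m - phi n.
Proof. by rewrite pairingB !pairing_mon. Qed.

Lemma pairingZ c x : pairing (c *: x) = c * pairing x.
Proof.
rewrite /pairing (mmapEw (msuppZ_le _ _)) mmapE big_distrr /=.
by apply: eq_bigr => k _; rewrite mcoeffZ mulrA.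
Qed.

End Pairing.

Lemma malgUZ (c : rat) (k : PM2) : << c *g k >> = c *: (<< k >> : {malg rat[PM2]}).
Proof. by apply/malgP => m; rewrite mcoeffZ !mcoeffU mulrnAr mulr1. Qed.

Lemma QM2E (x : QM2) : x = \sum_(k <- msupp x) x@_k *: mon k.
Proof.
rewrite {1}[x]monalgE; apply: eq_bigr => k _.
exact: malgUZ.
Qed.

Lemma pairing_mull phi g x :
  pairing phi (mon g * x) = pairing (fun k => phi (g * k)%g) x.
Proof.
rewrite [x in LHS]QM2E mulr_sumr pairing_sum pairingE.
by apply: eq_bigr => k _; rewrite -scalerAr -monM pairingZ pairing_mon.
Qed.

Lemma pairing_mulr phi g x :
  pairing phi (x * mon g) = pairing (fun k => phi (k * g)%g) x.
Proof.
rewrite [x in LHS]QM2E mulr_suml pairing_sum pairingE.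
by apply: eq_bigr => k _; rewrite -scalerAl -monM pairingZ pairing_mon.
Qed.

Lemma eq_pairing phi psi x : phi =1 psi -> pairing phi x = pairing psi x.
Proof. by move=> e; rewrite !pairingE; apply: eq_bigr => k _; rewrite e. Qed.

(** Used with two relations: for [Teqv] it sums the coefficients over the orbit of $m$ under powers
    of $T$, for [Geqv] over the coset $\Gamma m$. *)
Definition coeff_on (e : rel PM2) (m : PM2) : QM2 -> rat :=
  pairing (fun k => (e k m)%:R).

Lemma coeff_on_mull (e : rel PM2) m g x : (forall k n, e (g * k)%g n = e k n) ->
  coeff_on e m (mon g * x) = coeff_on e m x.
Proof. by move=> h; rewrite [LHS]pairing_mull; apply: eq_pairing => k; rewrite h. Qed.

Lemma coeff_on_mulr (e : rel PM2) m g g' x :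
  (forall k n h, e k n -> e (k * h)%g (n * h)%g) ->
  (g * g' = 1 -> g' * g = 1 ->
  coeff_on e m (x * mon g) = coeff_on e (m * g') x)%g.
Proof.
move=> h gg' g'g; rewrite [LHS]pairing_mulr; apply: eq_pairing => k.
congr (nat_of_bool _)%:R; apply/idP/idP => /h.
  by move=> /(_ g'); rewrite -mulgA gg' mulg1.
by move=> /(_ g); rewrite -[(m * g' * g)%g]mulgA g'g mulg1.
Qed.

(** * Elements supported in a given set *)

Section Support.
Variable Delta : PM2 -> Prop.

Lemma in_RD x y : in_R Delta x -> in_R Delta y -> in_R Delta (x + y).
Proof.
move=> hx hy m /(fsubsetP (msuppD_le _ _)); rewrite inE => /orP[]; [exact: hx|exact: hy].
Qed.

Lemma in_R0 : in_R Delta 0.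
Proof. by move=> m; rewrite msupp0 inE. Qed.

Lemma in_RZ c x : in_R Delta x -> in_R Delta (c *: x).
Proof. by move=> hx m /(fsubsetP (msuppZ_le _ _)); exact: hx. Qed.

Lemma in_RB x y : in_R Delta x -> in_R Delta y -> in_R Delta (x - y).
Proof. by move=> hx hy; rewrite -scaleN1r; apply: in_RD => //; apply: in_RZ. Qed.

Lemma in_R_mon m : Delta m -> in_R Delta (mon m).
Proof. by move=> hm n; rewrite /mon msuppU oner_eq0 inE => /eqP->. Qed.

Lemma in_R_sum (I : eqType) (s : seq I) (F : I -> QM2) :
  (forall i, i \in s -> in_R Delta (F i)) -> in_R Delta (\sum_(i <- s) F i).
Proof.
move=> h; rewrite big_seq; apply: big_ind => //; [exact: in_R0|exact: in_RD].
Qed.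

Lemma in_R_mull g x : (forall m, Delta m -> Delta (g * m)%g) ->
  in_R Delta x -> in_R Delta (mon g * x).
Proof.
move=> hg hx; rewrite [x]QM2E mulr_sumr; apply: in_R_sum => k /hx Dk.
by rewrite -scalerAr -monM; apply/in_RZ/in_R_mon/hg.
Qed.

End Support.

(** * Computing with explicit matrices modulo sign *)

(* The class of the identity when [a * d - b * c <= 0]. *)
Definition pmx a b c d : PM2 := \pi_PM2%qT (insubd posmx1 (mx2 a b c d)).

Lemma pmxE a b c d (h : 0 < \det (mx2 a b c d)) : pmcls h = pmx a b c d.
Proof. by rewrite /pmx /insubd insubT. Qed.

Lemma val_insubd_mx2 a b c d : 0 < a * d - b * c ->
  val (insubd posmx1 (mx2 a b c d)) = mx2 a b c d.
Proof. by move=> h; rewrite insubdK // unfold_in det_mx2E. Qed.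

Lemma pmxM a b c d a' b' c' d' : 0 < a * d - b * c -> 0 < a' * d' - b' * c' ->
  (pmx a b c d * pmx a' b' c' d')%g =
  pmx (a * a' + b * c') (a * b' + b * d') (c * a' + d * c') (c * b' + d * d').
Proof.
move=> h h'; rewrite /pmx [LHS]piE; apply/eqP/pi_eqP; left => /=.
rewrite !val_insubd_mx2 // ?mx2M //.
have -> : (a * a' + b * c') * (c * b' + d * d') - (a * b' + b * d') * (c * a' + d * c') =
  (a * d - b * c) * (a' * d' - b' * c') by ring.
exact: mulr_gt0.
Qed.

Lemma pmxP m : exists a b c d, 0 < a * d - b * c /\ m = pmx a b c d.
Proof.
elim/quotW: m => A; have := valP A; rewrite det_mx2 => h.
exists (val A 0 0), (val A 0 1), (val A 1 0), (val A 1 1); split=> //.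
by congr (\pi_PM2%qT _); apply: val_inj; rewrite val_insubd_mx2 // -mx2_eta.
Qed.

Lemma pmxN a b c d : 0 < a * d - b * c -> pmx (- a) (- b) (- c) (- d) = pmx a b c d.
Proof.
move=> h; apply/eqP/pi_eqP; right.
by rewrite !val_insubd_mx2 ?mx2N // !mulrNN.
Qed.

Lemma pm_det_pmx a b c d : 0 < a * d - b * c -> pm_det (pmx a b c d) = a * d - b * c.
Proof. by move=> h; rewrite piE val_insubd_mx2 // det_mx2E. Qed.

Lemma fixes_inf_pmx a b c d : 0 < a * d - b * c -> fixes_inf (pmx a b c d) = (c == 0).
Proof. by move=> h; rewrite piE val_insubd_mx2 // !mxE. Qed.

Lemma matSE : matS = pmx 0 (-1) 1 0. Proof. exact: pmxE. Qed.
Lemma matUE : matU = pmx 1 (-1) 1 0. Proof. exact: pmxE. Qed.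
Lemma matTE : matT = pmx 1 1 0 1. Proof. exact: pmxE. Qed.

Lemma pm1E : (1 : PM2)%g = pmx 1 0 0 1.
Proof.
apply/eqP/pi_eqP; left; rewrite val_insubd_mx2 //=.
by rewrite [LHS]mx2_eta !mxE.
Qed.

Lemma matSS : (matS * matS = 1)%g.
Proof. by rewrite matSE pm1E pmxM // -pmxN. Qed.

Lemma matTS : (matT * matS = matU)%g.
Proof. by rewrite matT_US -mulgA matSS mulg1. Qed.

Lemma matU3 : (matU * (matU * matU) = 1)%g.
Proof. by rewrite matUE pm1E !pmxM // -pmxN. Qed.

Lemma mulS a b c d : 0 < a * d - b * c -> (pmx a b c d * matS)%g = pmx b (- a) d (- c).
Proof. by move=> h; rewrite matSE pmxM //; congr pmx; ring. Qed.

Lemma mulU a b c d : 0 < a * d - b * c ->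
  (pmx a b c d * matU)%g = pmx (a + b) (- a) (c + d) (- c).
Proof. by move=> h; rewrite matUE pmxM //; congr pmx; ring. Qed.

Lemma mulTr a b c d : 0 < a * d - b * c ->
  (pmx a b c d * matT)%g = pmx a (a + b) c (c + d).
Proof. by move=> h; rewrite matTE pmxM //; congr pmx; ring. Qed.

(** * Orbits of powers of $T$ and cosets of $\Gamma$ *)

Definition Tpow (j : int) : PM2 := pmx 1 j 0 1.

Lemma TpowD i j : (Tpow i * Tpow j = Tpow (i + j))%g.
Proof. by rewrite /Tpow pmxM; first [lia | congr pmx; ring]. Qed.

Lemma Tpow0 : Tpow 0 = 1%g. Proof. by rewrite pm1E. Qed.

Lemma mulT a b c d j : 0 < a * d - b * c ->
  (Tpow j * pmx a b c d)%g = pmx (a + j * c) (b + j * d) c d.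
Proof. by move=> h; rewrite pmxM; first [lia | congr pmx; ring]. Qed.

Lemma mulTpow a b c d j : 0 < a * d - b * c ->
  (pmx a b c d * Tpow j)%g = pmx a (a * j + b) c (c * j + d).
Proof. by move=> h; rewrite pmxM; first [lia | congr pmx; ring]. Qed.

(** Boolean-valued by excluded middle, so that it can serve as a 0/1 weight in [coeff_on] and as a
    predicate for [choose]. *)
Definition Teqv : rel PM2 := fun m n => `[< exists j, m = (Tpow j * n)%g >].
Definition Geqv : rel PM2 := fun m n => `[< exists2 g, g \in PSL2Z & m = (g * n)%g >].

Lemma TeqvP m n : reflect (exists j, m = (Tpow j * n)%g) (Teqv m n).
Proof. exact: asboolP. Qed.

Lemma GeqvP m n : reflect (exists2 g, g \in PSL2Z & m = (g * n)%g) (Geqv m n).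
Proof. exact: asboolP. Qed.

Lemma Teqv_refl : reflexive Teqv.
Proof. by move=> m; apply/TeqvP; exists 0; rewrite Tpow0 mul1g. Qed.

Lemma Teqv_sym : symmetric Teqv.
Proof.
suff h m n : Teqv m n -> Teqv n m by move=> m n; apply/idP/idP; apply: h.
move=> /TeqvP[j ->]; apply/TeqvP; exists (- j).
by rewrite mulgA TpowD addNr Tpow0 mul1g.
Qed.

Lemma Teqv_trans : transitive Teqv.
Proof.
by move=> n m p /TeqvP[i ->] /TeqvP[j ->]; apply/TeqvP; exists (i + j); rewrite mulgA TpowD.
Qed.

Lemma Teqv_mulr k n h : Teqv k n -> Teqv (k * h)%g (n * h)%g.
Proof. by move=> /TeqvP[j ->]; apply/TeqvP; exists j; rewrite mulgA. Qed.

Lemma Teqv_Tl j k n : Teqv (Tpow j * k)%g n = Teqv k n.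
Proof.
have h : Teqv (Tpow j * k)%g k by apply/TeqvP; exists j.
by apply/idP/idP; apply: Teqv_trans => //; rewrite Teqv_sym.
Qed.

Lemma Tpow_PSL j : Tpow j \in PSL2Z.
Proof. by rewrite inE pm_det_pmx; lia. Qed.

Lemma S_PSL : matS \in PSL2Z.
Proof. by rewrite inE matSE pm_det_pmx. Qed.

Lemma pm1_PSL : (1%g : PM2) \in PSL2Z.
Proof. by rewrite -Tpow0 Tpow_PSL. Qed.

Lemma matT_Tpow : matT = Tpow 1. Proof. exact: matTE. Qed.

Lemma Geqv_refl : reflexive Geqv.
Proof. by move=> m; apply/GeqvP; exists 1%g; rewrite ?mul1g ?pm1_PSL. Qed.

Lemma Geqv_sym : symmetric Geqv.
Proof.
suff h m n : Geqv m n -> Geqv n m by move=> m n; apply/idP/idP; apply: h.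
move=> /GeqvP[g /PSL2Z_inv [g' g'G g'g] ->]; apply/GeqvP; exists g' => //.
by rewrite mulgA g'g mul1g.
Qed.

Lemma Geqv_trans : transitive Geqv.
Proof.
move=> n m p /GeqvP[g gG ->] /GeqvP[h hG ->]; apply/GeqvP; exists (g * h)%g.
  exact: PSL2Z_mul.
by rewrite mulgA.
Qed.

Lemma Geqv_mulr k n h : Geqv k n -> Geqv (k * h)%g (n * h)%g.
Proof. by move=> /GeqvP[g gG ->]; apply/GeqvP; exists g; rewrite ?mulgA. Qed.

Lemma Geqv_mull g k n : g \in PSL2Z -> Geqv (g * k)%g n = Geqv k n.
Proof.
move=> gG; have h : Geqv (g * k)%g k by apply/GeqvP; exists g.
by apply/idP/idP; apply: Geqv_trans => //; rewrite Geqv_sym.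
Qed.

Lemma Teqv_Geqv m n : Teqv m n -> Geqv m n.
Proof. by move=> /TeqvP[j ->]; rewrite Geqv_mull ?Tpow_PSL ?Geqv_refl. Qed.

(* An element of PSL2(Z) relating two matrices that fix infinity fixes it
   too, and is therefore a power of T. *)
Lemma Geqv_Teqv m n : fixes_inf m -> fixes_inf n -> Geqv m n -> Teqv m n.
Proof.
have [a [b [c [d [hn ->]]]]] := pmxP n.
move=> hm0 hn0 /GeqvP[g + Em]; move: hm0 hn0; rewrite {m}Em.
have [p [q [s [t [hg ->]]]]] := pmxP g.
have hgn : 0 < (p * a + q * c) * (s * b + t * d) - (p * b + q * d) * (s * a + t * c).
  by apply: etrans (mulr_gt0 hg hn); congr (0 < _); ring.
rewrite (pmxM hg hn) (fixes_inf_pmx hgn) (fixes_inf_pmx hn).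
move=> /eqP + /eqP c0 +; move: hn hgn; rewrite c0 !mulr0 !addr0 => hn _ /eqP.
rewrite mulf_eq0 => /orP[/eqP s0|/eqP a0]; last by move: hn; rewrite a0 mul0r.
move: hg; rewrite s0 mulr0 subr0 => hg; rewrite inE pm_det_pmx mulr0 subr0 // => /eqP pt1.
have h : 0 < a * d - b * 0 by rewrite mulr0 subr0.
have [[-> ->]|[-> ->]] : (p = 1 /\ t = 1) \/ (p = -1 /\ t = -1).
  have [p_gt0|p_le0] := ltrP 0 p; [left|right].
    have t_gt0 : 0 < t by nia.
    have p1 : p = 1 by nia.
    lia.
  have t_lt0 : t < 0 by nia.
  have p1 : p = -1 by nia.
  lia.
  apply/TeqvP; exists q; rewrite mulT //; congr pmx; ring.
(* Modulo sign, the matrix with rows $(-1, q)$ and $(0, -1)$ is $T^{-q}$. *)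
apply/TeqvP; exists (- q); rewrite mulT // -[RHS]pmxN; last by nia.
by congr pmx; ring.
Qed.

(* Generic ring lemmas cannot be rewritten with directly in QM2: unification
   would compare [1] with [mon matT] by computing in PM2. *)
Lemma mulr_1subl (R : pzRingType) (t x : R) : (1 - t) * x = x - t * x.
Proof. by rewrite mulrBl mul1r. Qed.

Lemma mulr_1subr (R : pzRingType) (t x : R) : x * (1 - t) = x - x * t.
Proof. by rewrite mulrBr mulr1. Qed.

Lemma one_sub_mul_one_add (R : pzRingType) (s : R) : s * s = 1 -> (1 - s) * (1 + s) = 0.
Proof. by move=> ss; rewrite mulr_1subl mulrDr mulr1 ss [s + 1]addrC subrr. Qed.

Lemma mul_orbit_sum3 (R : pzRingType) (u : R) :
  u * (u * u) = 1 -> u * (1 + u + u ^+ 2) = 1 + u + u ^+ 2.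
Proof. by move=> u3; rewrite expr2 !mulrDr mulr1 u3 addrC addrA. Qed.

(** Here $t(sp) = up = p$, so $p - sp$ is $-(1-t)$ applied to $sp$. With $TS = U$ this turns
    $(1-S)\pi_U$ into a left multiple of $1-T$. *)
Lemma one_sub_factor (R : pzRingType) (t s u p : R) :
  t * s = u -> u * p = p -> (1 - s) * p = (1 - t) * - (s * p).
Proof. by move=> ts up; rewrite mulrN !mulr_1subl mulrA ts up opprB. Qed.

Lemma mulr_left_kill (R : pzRingType) (x y a : R) : x * y = 0 ->
  forall z b, x * (y * a + z * b) = x * z * b.
Proof. by move=> xy z b; rewrite mulrDr !mulrA xy mul0r add0r. Qed.

Lemma coeff_on_1subT e m x : (forall j k n, e (Tpow j * k)%g n = e k n) ->
  coeff_on e m ((1 - mon matT) * x) = 0.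
Proof.
move=> he; rewrite mulr_1subl /coeff_on pairingB matT_Tpow.
by rewrite -!/(coeff_on e m _) coeff_on_mull ?subrr // => k n; apply: he.
Qed.

Lemma coeff_onD e m x y : coeff_on e m (x + y) = coeff_on e m x + coeff_on e m y.
Proof. exact: pairingD. Qed.

Lemma coeff_onB e m x y : coeff_on e m (x - y) = coeff_on e m x - coeff_on e m y.
Proof. exact: pairingB. Qed.

(** * The image of $1-T$, characterised by orbit sums *)

Section ImageOneMinusT.
Variable Delta : PM2 -> Prop.
Hypothesis DeltaT : forall j m, Delta m -> Delta (Tpow j * m)%g.

(** [eqmod_1T Delta x y] unfolds to this predicate at [x - y]. *)
Definition in_1T (x : QM2) : Prop :=
  exists2 z : QM2, in_R Delta z & x = (1 - mon matT) * z.

Lemma in_1TD x y : in_1T x -> in_1T y -> in_1T (x + y).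
Proof.
move=> [z hz ->] [t ht ->]; exists (z + t); first exact: in_RD.
by rewrite mulrDr.
Qed.

Lemma in_1TZ c x : in_1T x -> in_1T (c *: x).
Proof.
by move=> [z hz ->]; exists (c *: z); [exact: in_RZ|rewrite -scalerAr].
Qed.

Lemma in_1T0 : in_1T 0.
Proof. by exists 0; [exact: in_R0|rewrite mulr0]. Qed.

Lemma in_1T_sum (I : eqType) (s : seq I) (F : I -> QM2) :
  (forall i, i \in s -> in_1T (F i)) -> in_1T (\sum_(i <- s) F i).
Proof.
move=> h; rewrite big_seq; apply: big_ind => //; [exact: in_1T0|exact: in_1TD].
Qed.

(** For $j \ge 0$ the difference telescopes through the $T^i m$. For $j < 0$ the same argument
    starts at $T^j m$ and the sign is reversed. *)
Lemma in_1T_Tpow j m : Delta m -> in_1T (mon m - mon (Tpow j * m)%g).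
Proof.
have pos (n : nat) k : Delta k -> in_1T (mon k - mon (Tpow n%:Z * k)%g).
  elim: n k => [|n IH] k Dk; first by rewrite Tpow0 mul1g subrr; exact: in_1T0.
  have D1 : Delta (Tpow 1 * k)%g by exact: DeltaT.
  rewrite -[X in in_1T X](subrKA (mon (Tpow 1 * k)%g)); apply: in_1TD.
    by exists (mon k); [exact: in_R_mon|by rewrite mulr_1subl -matT_Tpow monM].
  by have := IH _ D1; rewrite mulgA TpowD -addn1 PoszD.
move=> Dm; have [j0|j0] := leP 0 j.
  by rewrite -(gez0_abs j0); apply: pos.
have := pos (absz j) _ (DeltaT j Dm); rewrite mulgA TpowD.
have -> : (absz j)%:Z + j = 0 by lia.
by rewrite Tpow0 mul1g => /(in_1TZ (-1)); rewrite scaleN1r opprB.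
Qed.

Definition trep (m : PM2) : PM2 := choose (Teqv m) m.

Lemma Teqv_trep m : Teqv m (trep m).
Proof. exact/chooseP/Teqv_refl. Qed.

(** The value of [choose] depends only on the predicate, and [Teqv m] and [Teqv n] agree pointwise
    when $m$ and $n$ share an orbit. *)
Lemma eq_trep m n : (trep m == trep n) = Teqv m n.
Proof.
apply/eqP/idP => [e|mn].
  by apply: (Teqv_trans (Teqv_trep m)); rewrite e Teqv_sym Teqv_trep.
have e : Teqv m =1 Teqv n.
  by move=> k; apply/idP/idP; apply: Teqv_trans; rewrite // Teqv_sym.
by rewrite /trep (eq_choose e); apply: choose_id; rewrite // -?e ?Teqv_refl // Teqv_sym.
Qed.

Lemma coeff_on_1T e m x : (forall j k n, e (Tpow j * k)%g n = e k n) ->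
  in_1T x -> coeff_on e m x = 0.
Proof. by move=> he [z _ ->]; apply: coeff_on_1subT. Qed.

(** Replacing each $k$ in the support by its orbit representative changes $x$ by an element of
    $(1-T)\mathcal R_\Delta$. What results has the orbit sums of $x$ as coefficients, so it is
    $0$. *)
Lemma in_1T_coeff x : in_R Delta x -> (forall m, coeff_on Teqv m x = 0) -> in_1T x.
Proof.
move=> hx x0.
have p0 : \sum_(k <- msupp x) x@_k *: mon (trep k) = 0 :> {malg rat[PM2]}.
  apply/malgP => m; rewrite mcoeff0 raddf_sum /=.
  have E k : (x@_k *: mon (trep k) : {malg rat[PM2]})@_m = x@_k * (trep k == m)%:R.
    by rewrite mcoeffZ; congr (_ * _); exact: mcoeffU.
  under eq_bigr do rewrite E.
  have [[k0 <-]|nex] := pselect (exists k0, trep k0 = m).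
    rewrite -[RHS](x0 k0) /coeff_on pairingE.
    by apply: eq_bigr => k _; rewrite eq_trep.
  by rewrite big1 // => k _; case: eqP => [ek|]; [case: nex; exists k|rewrite mulr0].
rewrite [x]QM2E -[X in in_1T X]subr0 -[X in _ - X]p0 -sumrB; apply: in_1T_sum => k /hx Dk.
rewrite -scalerBr; apply: in_1TZ; have /TeqvP[j ->] : Teqv (trep k) k.
  by rewrite Teqv_sym Teqv_trep.
exact: in_1T_Tpow.
Qed.

End ImageOneMinusT.

(** * Relations between the orbit sums of $(1-S)\xi$ for $\xi$ in $\mathcal A$ *)

Lemma one_subS_piS : (1 - mon matS) * piS = 0.
Proof.
rewrite -scalerAr one_sub_mul_one_add; first exact: scaler0.
by rewrite -monM matSS.
Qed.

Lemma one_subS_piU : (1 - mon matS) * piU = (1 - mon matT) * - (mon matS * piU).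
Proof.
have uE : mon matU * piU = piU.
  by rewrite -scalerAr mul_orbit_sum3 // -!monM matU3.
by apply: one_sub_factor uE; rewrite -monM matTS.
Qed.

Lemma coeff_on_I m x : in_I x -> coeff_on Teqv m ((1 - mon matS) * x) = 0.
Proof.
move=> [a [b ->]]; rewrite (mulr_left_kill a one_subS_piS piU b).
rewrite one_subS_piU.
rewrite -mulrA; apply: coeff_on_1subT; exact: Teqv_Tl.
Qed.

(** Strips the scalars $1/2$ and $1/3$ from [piS] and [piU]. *)
Lemma coeff_on_scaled e m (c : rat) (z x y : QM2) : c != 0 ->
  coeff_on e m (z * (x * (c *: y))) = 0 -> coeff_on e m (z * x * y) = 0.
Proof.
move=> c0; rewrite mulrA -scalerAr /coeff_on pairingZ => /eqP.
by rewrite mulf_eq0 (negPf c0) => /eqP.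
Qed.

Lemma mulr_orbit_sum2 (R : pzRingType) (x s : R) : x * (1 + s) = x + x * s.
Proof. by rewrite mulrDr mulr1. Qed.

Lemma mulr_orbit_sum3 (R : pzRingType) (x u : R) :
  x * (1 + u + u ^+ 2) = x + x * u + x * u * u.
Proof. by rewrite !mulrDr mulr1 expr2 mulrA. Qed.

Lemma coeff_on_mulrS m x : coeff_on Teqv m (x * mon matS) = coeff_on Teqv (m * matS)%g x.
Proof. exact: coeff_on_mulr Teqv_mulr matSS matSS. Qed.

Lemma coeff_on_mulrU m x :
  coeff_on Teqv m (x * mon matU) = coeff_on Teqv (m * (matU * matU))%g x.
Proof. by apply: coeff_on_mulr Teqv_mulr matU3 _; rewrite -mulgA matU3. Qed.

Lemma coeff_on_A_S xi m : in_A xi ->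
  coeff_on Teqv m ((1 - mon matS) * xi) +
  coeff_on Teqv (m * matS)%g ((1 - mon matS) * xi) = 0.
Proof.
move=> [/(coeff_on_I m) h _]; move: (coeff_on_scaled (c := 2^-1) isT h).
move: ((1 - mon matS) * xi) => z.
by rewrite mulr_orbit_sum2 coeff_onD (coeff_on_mulrS m z).
Qed.

(** Multiplying on the right by $U$ moves the orbit sum from $m$ to $mU^{-1} = mU^2$, and by $U^2$
    to $mU$. The last two terms thus appear exchanged. *)
Lemma coeff_on_A_U xi m : in_A xi ->
  coeff_on Teqv m ((1 - mon matS) * xi) +
  coeff_on Teqv (m * matU)%g ((1 - mon matS) * xi) +
  coeff_on Teqv (m * matU * matU)%g ((1 - mon matS) * xi) = 0.
Proof.
move=> [_ /(coeff_on_I m) h]; move: (coeff_on_scaled (c := 3^-1) isT h).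
move: ((1 - mon matS) * xi) => z.
rewrite mulr_orbit_sum3 2!coeff_onD => <-; rewrite addrAC.
congr (_ + _ + _); first by rewrite [RHS]coeff_on_mulrU mulgA.
rewrite [RHS]coeff_on_mulrU [RHS]coeff_on_mulrU.
by rewrite -!mulgA matU3 mulg1.
Qed.

(** * Finitely supported cycles vanish off the cusps *)

(** Absolute values make the sign chosen by [repr] immaterial. Left multiplication by powers of $T$
    fixes the bottom row, so this is a function of the orbit. *)
Definition height (m : PM2) : nat :=
  let A := val (repr m) in (absz (A 1%R 0%R) + absz (A 1%R 1%R))%N.

Lemma height_pmx a b c d : (0 < a * d - b * c)%R ->
  height (pmx a b c d) = (absz c + absz d)%N.
Proof.
move=> h; rewrite /height /pmx.
by case: (val_reprP (insubd posmx1 (mx2 a b c d))) => ->;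
  rewrite val_insubd_mx2 // !mxE /= ?abszN.
Qed.

Lemma height_Teqv m n : Teqv m n -> height m = height n.
Proof.
have [a [b [c [d [h ->]]]]] := pmxP n; move=> /TeqvP[j ->].
rewrite mulT // !height_pmx //.
by apply: etrans h; congr (0 < _); ring.
Qed.

Lemma coeff_on_height x : exists N : nat, forall m, (N <= height m)%N -> coeff_on Teqv m x = 0.
Proof.
exists (\max_(k <- msupp x) height k).+1 => m hm; rewrite /coeff_on pairingE big_seq big1 //.
move=> k kx; case: (boolP (Teqv k m)) => [/height_Teqv e|_]; last by rewrite mulr0.
by move: hm; rewrite -e ltnNge (leq_bigmax_seq (F := height)).
Qed.

Section Cycle.
Variable Z : PM2 -> rat.
Hypothesis ZS : forall m, Z m + Z (m * matS)%g = 0.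
Hypothesis ZU : forall m, Z m + Z (m * matU)%g + Z (m * matU * matU)%g = 0.
Hypothesis Zfin : exists N : nat, forall m, (N <= height m)%N -> Z m = 0.

(* The other two members of the U-orbit of a matrix whose bottom row has both
   entries of the same sign are sent by S to such matrices of larger height.  *)
Lemma cycle_pos a b c d : 0 < a * d - b * c -> 0 < c * d -> Z (pmx a b c d) = 0.
Proof.
have [N ZN] := Zfin.
(* Downward induction on the height: [n] bounds how far it lies below [N], from where on [Z]
   vanishes. *)
suff h (n : nat) a' b' c' d' : 0 < a' * d' - b' * c' -> 0 < c' * d' ->
    (N <= n + (absz c' + absz d'))%N -> Z (pmx a' b' c' d') = 0.
  by move=> h1 h2; apply: (h N) => //; apply: leq_addr.
elim: n a' b' c' d' => [|n IH] {}a {}b {}c {}d hdet cd hn.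
  by apply: ZN; rewrite height_pmx.
have sgn : (0 < c) && (0 < d) || (c < 0) && (d < 0) by nia.
have h1 : 0 < (a + b) * - c - - a * (c + d) by nia.
have h2 : 0 < (a + b - a) * - (c + d) - - (a + b) * (c + d - c) by nia.
have := ZU (pmx a b c d); rewrite mulU // mulU //.
(* The bottom rows reached are [(-c, -(c + d))], higher by $|c|$, and then [(-(c + d), -d)], higher
   by $|d|$. *)
have := ZS (pmx (a + b) (- a) (c + d) (- c)); rewrite mulS // (IH (- a)).
- rewrite addr0 => ->; rewrite addr0.
  have := ZS (pmx (a + b - a) (- (a + b)) (c + d - c) (- (c + d))).
  rewrite mulS // (IH (- (a + b))); [by rewrite addr0 => ->; rewrite addr0|nia|nia|].
  by case/orP: sgn => /andP[? ?]; lia.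
- nia.
- nia.
- by case/orP: sgn => /andP[? ?]; lia.
Qed.

(** If $cd < 0$, then $S$ sends the bottom row $(c, d)$ to $(d, -c)$, whose entries have the same
    sign. *)
Lemma cycle_generic a b c d : 0 < a * d - b * c -> c != 0 -> d != 0 ->
  Z (pmx a b c d) = 0.
Proof.
move=> h c0 d0; have cd0 := mulf_neq0 c0 d0; have [|ncd] := ltP 0 (c * d); first exact: cycle_pos.
have := ZS (pmx a b c d); rewrite mulS // (@cycle_pos b) ?addr0 //; lia.
Qed.

(** As $T^{-1} = SU^2$, the $U$-orbit of $mTS$ consists of $mTS$, $mTSU$ and $m$. The middle one has
    bottom row $(d, -d)$ with $d \ne 0$, so $Z(m) = -Z(mTS) = Z(mT)$. *)
Lemma cycle_inf m : fixes_inf m -> Z (m * matT)%g = Z m.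
Proof.
have [a [b [c [d [h ->]]]]] := pmxP m; rewrite fixes_inf_pmx // => /eqP c0.
move: h; rewrite c0 => h.
rewrite mulTr //; set m' := pmx _ _ _ _.
have e : pmx a b 0 d = (m' * matS * matU * matU)%g.
  rewrite /m' mulS; last by nia.
  rewrite mulU; last by nia.
  rewrite mulU; last by nia.
  rewrite -[LHS]pmxN //; congr pmx; ring.
have := ZU (m' * matS)%g; rewrite -e.
have -> : Z (m' * matS * matU)%g = 0.
  rewrite /m' mulS; last by nia.
  rewrite mulU; last by nia.
  by rewrite cycle_generic //; nia.
have := ZS m'; lra.
Qed.

End Cycle.

(** * Generation of $\Gamma$ by $S$ and $T$ *)

(** Euclid's algorithm on the bottom row, by strong induction on $|c|$: a power of $T$ on the right
    reduces $d$ modulo $c$, then $S$ exchanges the entries up to sign. When $c = 0$ the matrix is a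
    power of $T$. *)
Lemma PSL2Z_ST_ind (P : PM2 -> Prop) : P 1%g ->
  (forall g, P g -> P (g * matS)%g) -> (forall g, P (g * matT)%g <-> P g) ->
  forall h, h \in PSL2Z -> P h.
Proof.
move=> P1 PS PT.
have PTn (n : nat) g : P (g * Tpow n%:Z)%g <-> P g.
  elim: n g => [|n IH] g; first by rewrite Tpow0 mulg1.
  by rewrite -addn1 PoszD -TpowD -matT_Tpow mulgA PT.
have PTj j g : P (g * Tpow j)%g <-> P g.
  have [j0|j0] := leP 0 j; first by rewrite -(gez0_abs j0); apply: PTn.
  rewrite -(PTn (absz j)) -mulgA TpowD.
  have -> : j + (absz j)%:Z = 0 by lia.
  by rewrite Tpow0 mulg1.
move=> h; have [a [b [c [d [hdet ->]]]]] := pmxP h.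
rewrite inE pm_det_pmx // => /eqP det1.
have [n] := ubnP (absz c); elim: n a b c d {h} hdet det1 => // n IH a b c d _ det1 cn.
have hdet : 0 < a * d - b * c by rewrite det1.
have [c0|c0] := eqVneq c 0.
  move: det1; rewrite c0 mulr0 subr0 => ad1.
  have [[-> ->]|[-> ->]] : (a = 1 /\ d = 1) \/ (a = -1 /\ d = -1).
    have [a_gt0|a_le0] := ltrP 0 a; [left|right].
      have d_gt0 : 0 < d by nia.
      have a1 : a = 1 by nia.
      lia.
    have d_lt0 : d < 0 by nia.
    have a1 : a = -1 by nia.
    lia.
  by have := PTj b 1%g; rewrite mul1g => /iffRL; apply.
  rewrite -pmxN ?opprK ?oppr0; last by lia.
  by have := PTj (- b) 1%g; rewrite mul1g => /iffRL; apply.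
apply/(PTj (- (d %/ c)%Z)); rewrite mulTpow //.
set q := (d %/ c)%Z.
have e : d - q * c = (d %% c)%Z.
  by rewrite /q [X in X - _](divz_eq d c) addrAC subrr add0r.
have e' : c * - q + d = (d %% c)%Z by rewrite -e; ring.
rewrite e'; pose r := (d %% c)%Z; have r_ge0 : 0 <= r by rewrite modz_ge0.
have r_lt : r < `|c| by rewrite ltz_mod.
pose b' := a * - q + b; rewrite -/b' -/r.
have det' : b' * - c - - a * r = 1 by by rewrite /b' /r -e' -det1; ring.
have hh : 0 < a * r - b' * c by lia.
(* The left factor has lower-left entry $r$ with $|r| < |c|$, so induction applies to it. *)
have -> : pmx a b' c r = (pmx b' (- a) r (- c) * matS)%g.
  by rewrite -mulS // -mulgA matSS mulg1.
by apply/PS/IH; lia.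
Qed.

(** * Weighted sums over the representatives *)

Lemma double_coset_mulr delta g m :
  g \in PSL2Z -> double_coset delta m -> double_coset delta (m * g)%g.
Proof.
move=> gG [g1 [h [g1G hG ->]]]; exists g1, (h * g)%g; split=> //.
  exact: PSL2Z_mul.
by rewrite !mulgA.
Qed.

Lemma fixes_inf_Teqv m n : Teqv m n -> fixes_inf m = fixes_inf n.
Proof.
have [a [b [c [d [h ->]]]]] := pmxP n; move=> /TeqvP[j ->].
rewrite mulT // !fixes_inf_pmx //; nia.
Qed.

Lemma fixes_inf_mulT m : fixes_inf m -> fixes_inf (m * matT)%g.
Proof.
have [a [b [c [d [h ->]]]]] := pmxP m.
rewrite fixes_inf_pmx // mulTr // fixes_inf_pmx //; nia.
Qed.

Lemma fixes_inf_mulS m : fixes_inf m -> ~~ fixes_inf (m * matS)%g.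
Proof.
have [a [b [c [d [h ->]]]]] := pmxP m.
rewrite fixes_inf_pmx // mulS // fixes_inf_pmx //; nia.
Qed.

(** The class sum at $m$ of $\sum_r f(r)\,r$. General weights are needed because $Z(r)$ is not yet
    known to be constant. *)
Definition weighted_count (E : {fset PM2}) (f : PM2 -> rat) (e : rel PM2) m : rat :=
  \sum_(r <- E) f r * (e r m)%:R.

Lemma coeff_on_weighted (E : {fset PM2}) f (e : rel PM2) m :
  (forall k n h, e k n -> e (k * h)%g (n * h)%g) ->
  coeff_on e m (\sum_(r <- E) f r *: (mon r * (1 - mon matS))) =
  weighted_count E f e m - weighted_count E f e (m * matS)%g.
Proof.
move=> he; rewrite /coeff_on pairing_sum /weighted_count -sumrB.
apply: eq_bigr => r _.
rewrite pairingZ mulr_1subr -monM pairing_monB mulrBr.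
congr (_ - _ * (nat_of_bool _)%:R); apply/idP/idP => /(he _ _ matS).
  by rewrite -mulgA matSS mulg1.
by rewrite -[X in e _ X]mulgA matSS mulg1.
Qed.

Lemma weighted_count_single (E : {fset PM2}) f (e : rel PM2) m r : r \in E ->
  (forall r', r' \in E -> e r' m = (r' == r)) -> weighted_count E f e m = f r.
Proof.
move=> rE h; rewrite /weighted_count (big_fsetD1 r) //= h // eqxx mulr1 big_seq big1 ?addr0 //.
by move=> r'; rewrite !inE => /andP[/negPf r'r r'E]; rewrite h // r'r mulr0.
Qed.

Lemma weighted_count_none (E : {fset PM2}) f (e : rel PM2) m :
  (forall r', r' \in E -> e r' m -> f r' = 0) -> weighted_count E f e m = 0.
Proof.
move=> h; rewrite /weighted_count big_seq big1 // => r rE.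
by case: (boolP (e r m)) => [/(h _ rE)->|_]; rewrite ?mul0r ?mulr0.
Qed.

Section Representatives.
Variables (delta : PM2) (E : {fset PM2}).
Hypothesis hE : inf_reps (double_coset delta) E.
Notation Delta := (double_coset delta).

Lemma reps_uniq r r' m : r \in E -> r' \in E -> Geqv r m -> Geqv r' m -> r = r'.
Proof.
move=> rE r'E rm r'm; have [Dr _] := hE.1 _ rE; have [g gG e] := GeqvP _ _ rm.
have Dm : Delta m.
  by move: rm; rewrite Geqv_sym => /GeqvP[h hG ->]; apply: double_coset_mull.
have [r0 [_ u]] := hE.2 m Dm.
have ex x : Geqv x m -> exists2 g, g \in PSL2Z & m = (g * x)%g.
  by rewrite Geqv_sym => /GeqvP.
by rewrite -(u r) ?(u r') //; split=> //; apply: ex.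
Qed.

Lemma reps_ex m : Delta m -> exists2 r, r \in E & Geqv r m.
Proof.
by move=> /(hE.2 m) [r [[rE /GeqvP]]]; rewrite Geqv_sym => mr _; exists r.
Qed.

Lemma weighted_count_Geqv f r m : r \in E -> Geqv r m -> weighted_count E f Geqv m = f r.
Proof.
move=> rE rm; apply: weighted_count_single => // r' r'E.
by apply/idP/eqP => [r'm|->//]; apply: reps_uniq r'm rm.
Qed.

Lemma weighted_count_Teqv f r m : r \in E -> Teqv r m -> weighted_count E f Teqv m = f r.
Proof.
move=> rE rm; apply: weighted_count_single => // r' r'E.
by apply/idP/eqP => [r'm|->//]; apply: reps_uniq (Teqv_Geqv r'm) (Teqv_Geqv rm).
Qed.

Lemma weighted_count_not_inf f m : ~~ fixes_inf m -> weighted_count E f Teqv m = 0.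
Proof.
move=> hm; apply: weighted_count_none => r rE /fixes_inf_Teqv e.
by move: hm; rewrite -e (hE.1 _ rE).2.
Qed.

Lemma Delta_Teqv m n : Teqv m n -> Delta n -> Delta m.
Proof. by move=> /TeqvP[j ->]; apply: double_coset_mull; apply: Tpow_PSL. Qed.

Section Invariant.
Variable Z : PM2 -> rat.
Hypothesis ZTeqv : forall m n, Teqv m n -> Z m = Z n.
Hypothesis ZDelta : forall m, ~ Delta m -> Z m = 0.
Hypothesis Zinf : forall m, fixes_inf m -> Z (m * matT)%g = Z m.

(** The representative of $\Gamma m$ and $m$ itself both fix $\infty$, so they differ by a power of
    $T$ and have the same $Z$. Outside the double coset both sides are $0$. *)
Lemma weighted_count_inf m : fixes_inf m -> weighted_count E Z Teqv m = Z m.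
Proof.
move=> hm; have [Dm|nDm] := pselect (Delta m).
  have [r rE rm] := reps_ex Dm.
  have rm' : Teqv r m by apply: Geqv_Teqv => //; have [] := hE.1 _ rE.
  by rewrite (weighted_count_Teqv _ rE rm') (ZTeqv rm').
rewrite ZDelta //; apply: weighted_count_none => r rE rm.
by case: nDm; apply: (Delta_Teqv (n := r)); [rewrite Teqv_sym|have [] := hE.1 _ rE].
Qed.

(** The value on a coset can be read off from any of its elements that fixes $\infty$, whether or
    not it belongs to [E]. *)
Lemma weighted_count_Geqv_inf m n : Delta n -> fixes_inf n -> Geqv n m ->
  weighted_count E Z Geqv m = Z n.
Proof.
move=> Dn fn nm; have [r rE rn] := reps_ex Dn.
rewrite (weighted_count_Geqv _ rE (Geqv_trans rn nm)); apply: ZTeqv.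
by apply: Geqv_Teqv => //; have [] := hE.1 _ rE.
Qed.

(** If $r$ represents $\Gamma m$, then $rT$ lies in $\Gamma mT$ and still fixes $\infty$, and $Z(rT)
    = Z(r)$. *)
Lemma weighted_count_Geqv_T m : Delta m ->
  weighted_count E Z Geqv (m * matT)%g = weighted_count E Z Geqv m.
Proof.
move=> Dm; have [r rE rm] := reps_ex Dm; have [Dr fr] := hE.1 _ rE.
rewrite (weighted_count_Geqv _ rE rm) -(Zinf fr); apply: weighted_count_Geqv_inf.
- by apply: double_coset_mulr => //; rewrite matT_Tpow Tpow_PSL.
- exact: fixes_inf_mulT.
- exact: Geqv_mulr.
Qed.

Lemma weight_const :
  (forall m, weighted_count E Z Geqv (m * matS)%g = weighted_count E Z Geqv m) ->
  exists alpha, forall r, r \in E -> Z r = alpha.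
Proof.
move=> hS; exists (weighted_count E Z Geqv delta) => r rE.
rewrite -(weighted_count_Geqv Z rE (Geqv_refl r)).
have [[g [h [gG hG ->]]] _] := hE.1 _ rE.
have TG : matT \in PSL2Z by rewrite matT_Tpow Tpow_PSL.
have Dd : Delta (g * delta)%g by exists g, 1%g; rewrite mulg1 pm1_PSL.
transitivity (weighted_count E Z Geqv (g * delta)%g).
  (* Membership is carried along because invariance under $T$ is only available inside the double
     coset. *)
  pose P k := Delta (g * delta * k)%g /\
    weighted_count E Z Geqv (g * delta * k)%g = weighted_count E Z Geqv (g * delta)%g.
  suff [] : P h by [].
  apply: PSL2Z_ST_ind hG.
  - by rewrite /P mulg1.
  - move=> k [Dk ek]; rewrite /P mulgA hS; split=> //.
    exact: double_coset_mulr S_PSL Dk.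
  - move=> k; rewrite /P mulgA; split=> -[Dk ek].
      have Dk' : Delta (g * delta * k)%g.
        have -> : (g * delta * k = g * delta * k * matT * Tpow (-1))%g.
          by rewrite -[RHS]mulgA matT_Tpow TpowD Tpow0 mulg1.
        exact: double_coset_mulr (Tpow_PSL _) Dk.
      by split=> //; rewrite -weighted_count_Geqv_T.
    by split; [exact: double_coset_mulr|rewrite weighted_count_Geqv_T].
(* The left factor $g$ does not change the coset of $\delta$. *)
rewrite /weighted_count; apply: eq_bigr => k _.
by congr (_ * (nat_of_bool _)%:R); rewrite ![Geqv k _]Geqv_sym Geqv_mull.
Qed.

End Invariant.
End Representatives.

(** * The congruence and the uniqueness of its coefficient *)

Lemma scale_Tinf alpha (E : {fset PM2}) :
  alpha *: (Tinf E * (1 - mon matS)) = \sum_(r <- E) alpha *: (mon r * (1 - mon matS)).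
Proof. by rewrite /Tinf mulr_suml scaler_sumr. Qed.

Lemma coeff_on_out (Delta : PM2 -> Prop) (e : rel PM2) m x : in_R Delta x ->
  (forall k, Delta k -> e k m -> Delta m) -> ~ Delta m -> coeff_on e m x = 0.
Proof.
move=> hx he nD; rewrite /coeff_on pairingE big_seq big1 // => k /hx Dk.
by case: (boolP (e k m)) => [/(he _ Dk)//|_]; rewrite mulr0.
Qed.

Lemma in_R_one_subS delta x : in_R (double_coset delta) x ->
  in_R (double_coset delta) ((1 - mon matS) * x).
Proof.
move=> hx; rewrite mulr_1subl; apply: in_RB => //; apply: in_R_mull => // m.
exact: double_coset_mull S_PSL.
Qed.

Lemma in_R_Tinf delta E f : inf_reps (double_coset delta) E ->
  in_R (double_coset delta) (\sum_(r <- E) f r *: (mon r * (1 - mon matS))).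
Proof.
move=> hE; apply: in_R_sum => r /hE.1 [Dr _]; apply: in_RZ.
rewrite mulr_1subr -monM; apply: in_RB; apply: in_R_mon => //.
exact: double_coset_mulr S_PSL Dr.
Qed.

Theorem theorem2 (delta : PM2) (E : {fset PM2})
    (hE : inf_reps (double_coset delta) E)
    (xi : QM2) (hxi : in_AR (double_coset delta) xi) :
  exists! alpha : rat,
    eqmod_1T (double_coset delta)
      ((1 - mon matS) * xi) (alpha *: (Tinf E * (1 - mon matS))).
Proof.
have [xiA xiR] := hxi.
have zR := in_R_one_subS xiR.
have ZS m := coeff_on_A_S m xiA.
have ZU m := coeff_on_A_U m xiA.
(* Left multiplication by $S$ preserves each coset $\Gamma m$, so $\xi$ and $S\xi$ have equal coset
   sums. *)
have zG m : coeff_on Geqv m ((1 - mon matS) * xi) = 0.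
  rewrite mulr_1subl coeff_onB coeff_on_mull ?subrr // => k n.
  exact: Geqv_mull S_PSL.
move: ((1 - mon matS) * xi) zR ZS ZU zG => z zR ZS ZU zG {xi hxi xiA xiR}.
pose Z m := coeff_on Teqv m z.
have Zfin : exists N : nat, forall m, (N <= height m)%N -> Z m = 0 := coeff_on_height z.
have ZTeqv m n : Teqv m n -> Z m = Z n.
  move=> mn; apply: eq_pairing => k; congr (nat_of_bool _)%:R.
  by apply/idP/idP => /Teqv_trans; apply=> //; rewrite Teqv_sym.
have ZDelta m : ~ double_coset delta m -> Z m = 0.
  by apply: coeff_on_out zR _ => k Dk; rewrite Teqv_sym => /Delta_Teqv; apply.
have Zinf := cycle_inf ZS ZU Zfin.
have DT j m : double_coset delta m -> double_coset delta (Tpow j * m)%g.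
  exact: double_coset_mull (Tpow_PSL j).
pose w := \sum_(r <- E) Z r *: (mon r * (1 - mon matS)).
have zw : in_1T (double_coset delta) (z - w).
  apply: in_1T_coeff => // [|m]; first by apply: in_RB zR _; exact: in_R_Tinf.
  rewrite coeff_onB coeff_on_weighted; last exact: Teqv_mulr.
  apply/eqP; rewrite subr_eq0; apply/eqP; rewrite -/(Z m).
  (* The orbit sum of [w] at $m$ is $W(m) - W(mS)$, where $W$ is $Z$ on matrices fixing $\infty$ and
     $0$ elsewhere. The cases are $c = 0$, $d = 0$ and $cd \ne 0$. *)
  have [mi|nmi] := boolP (fixes_inf m).
    rewrite (weighted_count_inf hE ZTeqv ZDelta mi).
    by rewrite (weighted_count_not_inf hE) ?subr0 // fixes_inf_mulS.
  rewrite (weighted_count_not_inf hE) // sub0r.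
  have [mSi|nmSi] := boolP (fixes_inf (m * matS)%g).
    rewrite (weighted_count_inf hE ZTeqv ZDelta mSi).
    by apply/eqP; rewrite -addr_eq0; apply/eqP; exact: ZS.
  rewrite (weighted_count_not_inf hE) // oppr0.
  have [a [b [c [d [h em]]]]] := pmxP m; move: nmi nmSi; rewrite em mulS //.
  rewrite fixes_inf_pmx // fixes_inf_pmx; last by lia.
  exact: (cycle_generic ZS ZU Zfin).
(* Coset sums vanish on [z] and on the image of $1-T$, hence on [w], where they are the difference
   of the two sides. *)
have hS m : weighted_count E Z Geqv (m * matS)%g = weighted_count E Z Geqv m.
  have : coeff_on Geqv m (z - w) = 0.
    by apply: coeff_on_1T zw => j k n; apply: Geqv_mull (Tpow_PSL j).
  rewrite coeff_onB zG coeff_on_weighted; last exact: Geqv_mulr.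
  by rewrite sub0r => /eqP; rewrite oppr_eq0 subr_eq0 => /eqP.
have [alpha Zalpha] := weight_const hE ZTeqv Zinf hS.
exists alpha; split.
  have <- : w = alpha *: (Tinf E * (1 - mon matS)).
    by rewrite scale_Tinf /w; apply: eq_big_seq => r /Zalpha->.
  exact: zw.
move=> beta; rewrite scale_Tinf => hb.
(* For uniqueness, [E] is nonempty because it represents $\Gamma\delta$. At any $r$ in [E] the orbit
   sum of the right-hand side is [beta], since $rS$ does not fix $\infty$, whence [beta] is
   $Z(r)$. *)
have Dd : double_coset delta delta by exists 1%g, 1%g; rewrite mulg1 mul1g pm1_PSL.
have [r rE _] := reps_ex hE Dd.
have : coeff_on Teqv r (z - \sum_(r <- E) beta *: (mon r * (1 - mon matS))) = 0.
  by apply: coeff_on_1T hb; exact: Teqv_Tl.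
rewrite coeff_onB (coeff_on_weighted _ (fun=> beta)); last exact: Teqv_mulr.
rewrite (weighted_count_Teqv hE _ rE (Teqv_refl r)) (weighted_count_not_inf hE); last first.
  by apply: fixes_inf_mulS; have [] := hE.1 _ rE.
by rewrite subr0 -/(Z r) (Zalpha r rE) => /eqP; rewrite subr_eq0 => /eqP.
Qed.
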